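(* Let $F$ be an imaginary quadratic field with ring of integers $\mathcal{O}_F$, and let $A$ be a positive definite $2\times 2$ Hermitian matrix with complex entries (a positive definite binary Hermitian form). Then $\#\operatorname{Min}(A) \leq 12$.
   Context: Fix a complex embedding $F \hookrightarrow \mathbb{C}$, so that $\mathcal{O}_F^2 \subset \mathbb{C}^2$. For a $2\times 2$ Hermitian matrix $A$ and $x \in \mathbb{C}^2$, write $A[x] = \bar{x}^t A x$. For positive definite $A$, the minimum of $A$ is $\min(A) = \inf_{v \in \mathcal{O}_F^2 \setminus \{0\}} A[v]$ (which is positive), and a vector $v \in \mathcal{O}_F^2\setminus\{0\}$ is a minimal vector of $A$ if $A[v] = \min(A)$. The set $\operatorname{Min}(A)$ of minimal vectors is defined with the convention that, since $v$ is minimal if and only if $-v$ is, exactly one representative of each pair $\{\pm v\}$ is included in $\operatorname{Min}(A)$. *)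

(* Defs.v *)
From HB Require Import structures.
From mathcomp Require Import all_boot all_order all_algebra.
From mathcomp Require Import complex.
From mathcomp Require Import classical_sets reals.
Set Implicit Arguments. Unset Strict Implicit. Unset Printing Implicit Defensive.
Import Order.TTheory GRing.Theory Num.Theory.
Local Open Scope ring_scope.
Local Open Scope complex_scope.

(* The imaginary quadratic field F = Q(sqrt(-d)), d a positive integer, embedded in C
   via sqrt(-d) |-> i * sqrt(d). (Every imaginary quadratic field is of this form;
   the image does not depend on the choice of square root.) *)
Definition in_imquad (R : realType) (d : nat) (z : R[i]) : Prop :=
  exists a b : rat, z = ratr a + ratr b * ('i * (Num.sqrt (d%:R : R))%:C).

Definition is_alg_int (R : realType) (z : R[i]) : Prop :=
  exists p : {poly int}, p \is monic /\ root (map_poly (fun k : int => k%:~R) p) z.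

Definition in_OF (R : realType) (d : nat) (z : R[i]) : Prop :=
  in_imquad d z /\ is_alg_int z.

Definition in_OF2_nz (R : realType) (d : nat) (v : 'cV[R[i]]_2) : Prop :=
  (forall k, in_OF d (v k ord0)) /\ v != 0.

Definition hform (R : realType) (A : 'M[R[i]]_2) (x : 'cV[R[i]]_2) : R[i] :=
  \sum_(k < 2) \sum_(l < 2) (x k ord0)^* * A k l * x l ord0.

Definition hermitian (R : realType) (A : 'M[R[i]]_2) : Prop :=
  forall k l, A l k = (A k l)^*.

Definition posdef (R : realType) (A : 'M[R[i]]_2) : Prop :=
  hermitian A /\ forall x : 'cV[R[i]]_2, x != 0 -> 0 < hform A x.

(* min(A) = inf { A[v] : v in O_F^2 \ {0} } (A[v] is real; we take real parts). *)
Definition hmin (R : realType) (d : nat) (A : 'M[R[i]]_2) : R :=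
  inf [set complex.Re (hform A v) | v in in_OF2_nz d]%classic.

Definition is_min_vec (R : realType) (d : nat) (A : 'M[R[i]]_2) (v : 'cV[R[i]]_2) : Prop :=
  in_OF2_nz d v /\ hform A v = (hmin d A)%:C.

(* A sequence s is a valid choice of a subset of Min(A): minimal vectors, no two of
   them equal or opposite (one representative per pair {v, -v}).  #Min(A) <= n iff
   every such sequence has size <= n. *)
Definition min_reps (R : realType) (d : nat) (A : 'M[R[i]]_2) (s : seq 'cV[R[i]]_2) : Prop :=
  (forall v, v \in s -> is_min_vec d A v) /\
  (forall i j, (i < size s)%N -> (j < size s)%N -> i <> j ->
     nth 0 s i <> nth 0 s j /\ nth 0 s i <> - nth 0 s j).

(* Main.v *)
(* Minimal vectors of L = O_F^2 (a lattice of rank 4) are told apart, up to sign, by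
   their classes in L/2L, a space of dimension at most 4 over F_2: if u = v mod 2L,
   then (u + v)/2 and (u - v)/2 have norms of sum m = min(A), so one of them is 0.
   Likewise, if u + v + w lies in 2L for minimal u, v, w, then the norms of the four
   vectors (+-u +-v + w)/2 add up to 3m < 4m, so one of them is 0, whence
   2 Re<u,v> = +-m.  It follows that the 7 nonzero classes of a hyperplane of F_2^4
   cannot all be minimal: 2 Re<u +- v, w> would be both +-m and a sum of two terms +-m.
   But 13 nonzero vectors of F_2^4 leave out at most two nonzero ones, and some
   hyperplane avoids these two. *)

Require Import Defs.
From mathcomp Require Import all_boot all_order all_algebra.
From mathcomp Require Import complex.
From mathcomp Require Import boolp classical_sets reals.
From mathcomp Require Import zify ring lra.
Set Implicit Arguments. Unset Strict Implicit.
Import Order.TTheory GRing.Theory Num.Theory.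
Local Open Scope ring_scope.

(** * Hyperplanes in F_2^4 *)

(* F_2^4, as a type on which [vm_compute] can enumerate. *)
Definition code := (bool * bool * bool * bool)%type.

Definition code0 : code := (false, false, false, false).

Definition addc (c d : code) : code :=
  let: (c0, c1, c2, c3) := c in let: (d0, d1, d2, d3) := d in
  (c0 (+) d0, c1 (+) d1, c2 (+) d2, c3 (+) d3).

Definition bit (c : code) (i : nat) : bool :=
  let: (c0, c1, c2, c3) := c in nth false [:: c0; c1; c2; c3] i.

Lemma bit_addc c d i : bit (addc c d) i = bit c i (+) bit d i.
Proof.
case: c => [[[c0 c1] c2] c3]; case: d => [[[d0 d1] d2] d3].
by do 4?[case: i => [//|i]]; rewrite /= !nth_nil.
Qed.

Lemma bit_code0 i : bit code0 i = false.
Proof. by do 4?[case: i => [//|i]]; rewrite /= nth_nil. Qed.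

Definition fano (a b c : code) : seq code :=
  [:: a; b; c; addc a b; addc a c; addc b c; addc (addc a b) c].

(* Avoiding [code0] as well forces a, b, c to be independent, so that [fano a b c]
   lists the nonzero vectors of a hyperplane. *)
Lemma fano_avoid (p q : code) :
  exists a b c, all [pred x | x \notin [:: code0; p; q]] (fano a b c).
Proof.
pose B := [:: false; true].
pose Vs : seq code :=
  [seq (x, y) | x <- [seq (x, y) | x <- [seq (x, y) | x <- B, y <- B], y <- B], y <- B].
have inVs x : x \in Vs by case: x => [[[[] []] []] []].
pose some P := (find P Vs < size Vs)%N.
have someP P : some P -> exists x, P x by rewrite /some -has_find => /hasP[x _]; exists x.
(* [has] would be evaluated eagerly by [vm_compute] *)
have H : all (fun p => all (fun q => some (fun a => some (fun b => some (fun c =>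
    all [pred x | x \notin [:: code0; p; q]] (fano a b c))))) Vs) Vs.
  by vm_compute.
have /allP/(_ q (inVs q))/someP[a /someP[b /someP[c abc]]] := allP H p (inVs p).
by exists a, b, c.
Qed.

Lemma fano_in_large (cs : seq code) :
  uniq cs -> code0 \notin cs -> (12 < size cs)%N ->
  exists a b c, {subset fano a b c <= cs}.
Proof.
move=> Ucs cs0 lt12.
(* The nonzero vectors missing from [cs]: at most 16 - 13 - 1 = 2 of them. *)
pose r := rem code0 (enum [predC cs]).
have sz_r : (size r <= 2)%N.
  rewrite size_rem ?mem_enum ?inE // -cardE.
  move: (cardC (mem cs)); rewrite (card_uniqP Ucs) !card_prod card_bool => E.
  have -> : #|[predC cs]| = (16 - size cs)%N by rewrite -[16%N]E addKn; apply: eq_card.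
  by rewrite -subn1 -subnDA leq_subLR addnC; move: lt12; lia.
(* If [r] has fewer than two entries, the default [code0] fills in; this is harmless, as
   [fano_avoid] excludes [code0] anyway. *)
have [a [b [c /allP abc]]] := fano_avoid (nth code0 r 0) (nth code0 r 1).
exists a, b, c => x /abc; apply: contraR => xcs.
have : x \in code0 :: r.
  have := perm_to_rem (x := code0) (s := enum [predC cs]).
  by rewrite mem_enum inE => /(_ cs0)/perm_mem <-; rewrite mem_enum.
clear abc; clearbody r.
by case: r sz_r => [|p0 [|q0 [|]]] //= _; rewrite !inE; case: (x == code0) => //= ->.
Qed.

(** * Minimal vectors modulo 2L for a symmetric biadditive form *)

Section MinimalVectors.

Context {R : realFieldType} {V : zmodType} (b : V -> V -> R) (L : V -> Prop) (m : R).
Hypothesis bC : forall x y, b x y = b y x.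
Hypothesis bD : forall x y z, b (x + y) z = b x z + b y z.
Hypothesis L0 : L 0.
Hypothesis LB : forall x y, L x -> L y -> L (x - y).
Hypothesis m_gt0 : 0 < m.
Hypothesis L_min : forall x, L x -> x != 0 -> m <= b x x.

Definition minvec v := L v /\ b v v = m.
Definition even x := exists2 y, L y & x = y *+ 2.

Lemma form0l z : b 0 z = 0.
Proof. by apply: (addrI (b 0 z)); rewrite -bD !addr0. Qed.

Lemma formNl x z : b (- x) z = - b x z.
Proof. by apply: (addrI (b x z)); rewrite -bD !subrr form0l. Qed.

Lemma formDr z x y : b z (x + y) = b z x + b z y.
Proof. by rewrite !(bC z) bD. Qed.

Lemma formNr z x : b z (- x) = - b z x.
Proof. by rewrite !(bC z) formNl. Qed.

Let bE := (formNl, formNr, bD, formDr).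

Lemma minvec_neq0 v : minvec v -> v != 0.
Proof.
by move=> [_ bv]; apply/eqP => v0; move: m_gt0; rewrite -bv v0 form0l ltxx.
Qed.

Lemma L_opp x : L x -> L (- x).
Proof. by move=> Lx; rewrite -sub0r; apply: LB. Qed.

Lemma L_add x y : L x -> L y -> L (x + y).
Proof. by move=> Lx Ly; rewrite -[y]opprK; apply/LB/L_opp. Qed.

Lemma L_mulrn x k : L x -> L (x *+ k).
Proof. by move=> Lx; elim: k => [|k IH]; rewrite ?mulr0n // mulrS; apply: L_add. Qed.

Lemma even_add x y : even x -> even y -> even (x + y).
Proof.
by move=> [u Lu ->] [v Lv ->]; exists (u + v); [exact: L_add | rewrite mulrnDl].
Qed.

Lemma even_opp x : even x -> even (- x).
Proof. by move=> [u Lu ->]; exists (- u); [exact: L_opp | rewrite mulNrn]. Qed.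

(** If v = 2y, then y has norm m/4 < m, which forces y = 0 and v = 0. *)
Lemma minvec_not_even v : minvec v -> ~ even v.
Proof.
move=> mv [y Ly vE]; have := minvec_neq0 mv; have [_] := mv.
rewrite {1 2}vE mulr2n !bE => yy.
have [y0|y0 _] := eqVneq y 0; first by rewrite vE y0 mul0rn eqxx.
by have := L_min Ly y0; move: m_gt0 yy; lra.
Qed.

(* With u + v = 2y, the vectors y and y - u = (v - u)/2 have norms of sum m. *)
Lemma minvec_add_even u v : minvec u -> minvec v -> even (u + v) -> u = v \/ u = - v.
Proof.
move=> mu mv [y Ly uvE]; have [Lu bu] := mu; have [Lv bv] := mv.
have vE : v = y *+ 2 - u by rewrite -uvE addrC addKr.
have [y0|y0] := eqVneq y 0; first by right; rewrite vE y0 mul0rn sub0r opprK.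
have [yu|yu] := eqVneq (y - u) 0.
  by left; rewrite vE (subr0_eq yu) mulr2n addrK.
exfalso; have := L_min Ly y0; have := L_min (LB Ly Lu) yu.
move: m_gt0 bu bv; rewrite vE mulr2n !bE (bC u y); lra.
Qed.

(* With u + v + w = 2x, the norms of x, x - u, x - v and x - w add up to 3m, so
   one of these four vectors of L vanishes. *)
Lemma minvec_triple u v w : minvec u -> minvec v -> minvec w -> even (u + v + w) ->
  (w = u + v \/ w = u - v) \/ (w = - (u + v) \/ w = - (u - v)).
Proof.
move=> [Lu bu] [Lv bv] [Lw bw] [x Lx sE].
have wE : w = x *+ 2 - (u + v) by rewrite -sE addrC addKr.
have [x0|x0] := eqVneq x 0.
  by right; left; rewrite wE x0 mul0rn sub0r.
have [xu|xu] := eqVneq (x - u) 0.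
  left; right; rewrite wE (subr0_eq xu) mulr2n.
  by rewrite opprD addrA addrK.
have [xv|xv] := eqVneq (x - v) 0.
  right; right; rewrite wE (subr0_eq xv) mulr2n.
  by rewrite opprD addrA addrAC addrK opprB.
have [xw|xw] := eqVneq (x - w) 0.
  by left; left; apply: (addIr w); rewrite sE (subr0_eq xw) mulr2n.
exfalso; have := L_min Lx x0; have := L_min (LB Lx Lu) xu; have := L_min (LB Lx Lv) xv.
have := L_min (LB Lx Lw) xw.
move: m_gt0 bu bv bw; rewrite wE mulr2n !bE (bC u x) (bC v x) (bC v u); lra.
Qed.

(** As w is +-(u + v) or +-(u - v), expanding m = b(w,w) gives m = 2m +- 2b(u,v). *)
Lemma minvec_triple_form u v w : minvec u -> minvec v -> minvec w ->
  even (u + v + w) -> b u v *+ 2 = m \/ b u v *+ 2 = - m.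
Proof.
move=> mu mv mw e.
case: (minvec_triple mu mv mw e) (mw) (mu) (mv) => [[]|[]] -> [_ +] [_ +] [_ +];
  rewrite !bE (bC v u) mulr2n; (do [left; lra | right; lra]).
Qed.

(* As 2b(u,w) and 2b(v,w) are m or -m, 2b(u +- v, w) is 0, 2m or -2m. *)
Lemma minvec_no_fano u v w uv uw vw uvw :
  minvec u -> minvec v -> minvec w -> minvec uv -> minvec uw -> minvec vw ->
  minvec uvw -> even (u + v + uv) -> even (u + w + uw) -> even (v + w + vw) ->
  even (uv + w + uvw) -> False.
Proof.
move=> mu mv mw muv muw mvw muvw e1 e2 e3 e4.
have := minvec_triple_form mu mw muw e2; have := minvec_triple_form mv mw mvw e3.
have := minvec_triple_form muv mw muvw e4.
case: (minvec_triple mu mv muv e1) => [[]|[]] ->; rewrite !bE !mulr2n;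
  move: m_gt0 => ? [] ? [] ? [] ?; lra.
Qed.

(** * Coordinates on L/2L for a lattice of rank at most 4 *)

Hypothesis L_rank4 : forall e : 'I_5 -> V, (forall i, L (e i)) ->
  exists n : 'I_5 -> int,
    (exists i, ~~ (2 %| n i)%Z) /\ \sum_i e i *~ n i = 0.

(** Reducing the coefficients mod 2 changes the relation by twice a vector of L, and the odd
    coefficient keeps it nontrivial. *)
Lemma L_rank4_mod2 (e : 'I_5 -> V) : (forall i, L (e i)) ->
  exists a : 'I_5 -> bool, (exists i, a i) /\ even (\sum_i e i *+ a i).
Proof.
move=> Le; have [n [[i0 odd_i0] sum0]] := L_rank4 Le.
exists (fun i => ~~ (2 %| n i)%Z); split; first by exists i0.
have Lsum (k : 'I_5 -> int) : L (\sum_i e i *~ k i).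
  apply: (big_ind L) => // [|i _]; first exact: L_add.
  by case: (k i) => j; [apply: L_mulrn | apply/L_opp/L_mulrn].
exists (\sum_i e i *~ - (n i %/ 2)%Z); first exact: Lsum.
transitivity (\sum_i (e i *~ n i + e i *~ (- (n i %/ 2)%Z) *+ 2)); last first.
  by rewrite big_split /= sum0 add0r sumrMnl.
apply: eq_bigr => i _ /=.
rewrite (pmulrn (e i)) (pmulrn (e i *~ _)) -mulrzA -mulrzDr; congr (_ *~ _).
have := modz_ge0 (n i) (isT : 2%:Z != 0); have := ltz_mod (n i) (isT : 2%:Z != 0).
rewrite (_ : (2 %| n i)%Z = ((n i %% 2)%Z == 0)); last exact/dvdz_mod0P/eqP.
move: (divz_eq (n i) 2).
case: eqP => /=; lia.
Qed.

(** A family independent mod 2L that does not span L/2L can be extended by one vector; without a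
    spanning family of at most 4 vectors this would reach 5 independent ones. *)
Lemma mod2_basis : exists k (e : nat -> V), (k <= 4)%N /\
  (forall i, (i < k)%N -> L (e i)) /\
  forall x, L x -> exists a : nat -> bool, even (x + \sum_(i < k) e i *+ a i).
Proof.
apply: contrapT => no_basis.
suff ind k : (k <= 5)%N -> exists e : nat -> V, (forall i, (i < k)%N -> L (e i)) /\
    forall a : nat -> bool, (exists2 i, (i < k)%N & a i) ->
      ~ even (\sum_(i < k) e i *+ a i).
  have [e [Le ind5]] := ind 5%N isT.
  have [a [[i ai] ev]] := @L_rank4_mod2 (fun i : 'I_5 => e i) (fun i => Le i (ltn_ord i)).
  apply: (ind5 (fun i => a (inord i))); first by exists i; rewrite // inord_val.
  by under eq_bigr do rewrite inord_val.
elim: k => [|k IH] ltk5; first by exists (fun=> 0); split=> // a [].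
have [e [Le ind_e]] := IH (ltnW ltk5).
have [x [Lx x_ind]] : exists x, L x /\
    forall a : nat -> bool, ~ even (x + \sum_(i < k) e i *+ a i).
  apply: contrapT => no_x; apply: no_basis; exists k, e; split=> //; split=> // x Lx.
  by apply: contrapT => no_a; apply: no_x; exists x; split=> // a ev; apply: no_a; exists a.
exists (fun i => if (i < k)%N then e i else x); split=> [i _|a [i ltik ai]].
  by case: ifP => // /Le.
rewrite big_ord_recr /= ltnn.
under eq_bigr do rewrite ltn_ord.
(* A combination involving the new vector x is not even by the choice of x; any other one falls
   under the induction hypothesis. *)
case ak: (a k); first by rewrite mulr1n addrC; apply: x_ind.
rewrite mulr0n addr0; apply: ind_e; exists i => //.
by move: ltik; rewrite ltnS leq_eqVlt => /orP[/eqP ik|//]; rewrite ik ak in ai.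
Qed.

Lemma even_double x : L x -> even (x + x).
Proof. by move=> Lx; exists x; rewrite // mulr2n. Qed.

(* [f x] holds the coordinates of the class of x in L/2L, and [E] picks representatives. *)
Lemma mod2_code : exists (f : V -> code) (E : code -> V),
  [/\ forall x, L x -> even (x + E (f x)), E code0 = 0, forall c, L (E c) &
      forall c d, even (E c + E d + E (addc c d))].
Proof.
have [k [e [lek4 [Le basis]]]] := mod2_basis.
pose E c := \sum_(i < k) e i *+ bit c i.
have LE c : L (E c).
  by rewrite /E; apply: (big_ind L) => // [|i _]; [exact: L_add | exact/L_mulrn/Le].
have /choice[f fP] : forall x, exists c, L x -> even (x + E c).
  move=> x; have [Lx|nLx] := pselect (L x); last by exists code0.
  have [a ev] := basis x Lx; exists (a 0%N, a 1%N, a 2%N, a 3%N) => _.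
  congr (even (x + _)): ev; apply: eq_bigr => i _; congr (_ *+ nat_of_bool _).
  by case: i => i /= /leq_trans/(_ lek4); do 4?[case: i => [//|i]].
exists f, E; split=> //; first by apply: big1 => i _; rewrite bit_code0.
move=> c d; rewrite /E -!big_split /=; apply: (big_ind even).
- by exists 0; rewrite ?mul0rn.
- exact: even_add.
(* For bits read as natural numbers, c + d + (c xor d) = 2 (c or d). *)
- move=> i _; rewrite bit_addc; exists (e i *+ (bit c i || bit d i)).
    exact/L_mulrn/Le.
  by rewrite -!mulrnDr -mulrnA; case: (bit c i); case: (bit d i).
Qed.

(** * The bound for abstract lattices *)

Lemma size_minvecs (s : seq V) : (forall v, v \in s -> minvec v) -> uniq s ->
  (forall u v, u \in s -> v \in s -> u <> v -> u <> - v) -> (size s <= 12)%N.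
Proof.
move=> ms Us opp_s; have [f [E [fE E0 LE ED]]] := mod2_code.
(* Modulo 2L, x + y + z agrees with the sum of the three representatives, which is even by [ED]. *)
have ev3 x y z : L x -> L y -> L z -> f z = addc (f x) (f y) -> even (x + y + z).
  move=> Lx Ly Lz fz.
  have := even_add (even_add (even_add (fE x Lx) (fE y Ly)) (fE z Lz))
    (even_opp (ED (f x) (f y))).
  rewrite fz; congr even.
  by rewrite (addrACA x) (addrACA (x + y)) addrK.
have [//|lt12] := leqP (size s) 12.
(* Equal codes make u + v even, hence u = v or u = - v, and [opp_s] rules out the latter for
   distinct vectors. *)
have f_inj : {in s &, injective f}.
  move=> u v us vs fuv; have [mu mv] := (ms u us, ms v vs).
  have ev : even (u + v).
    have := even_add (even_add (fE u mu.1) (fE v mv.1))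
      (even_opp (even_double (LE (f u)))).
    by rewrite fuv addrACA addrK.
  have [//|/eqP uv] := eqVneq u v.
  by have [//|/(opp_s u v us vs uv)] := minvec_add_even mu mv ev.
have f0 : code0 \notin [seq f v | v <- s].
  apply/mapP => -[v vs fv]; apply: (minvec_not_even (ms v vs)).
  by have := fE v (ms v vs).1; rewrite -fv E0 addr0.
have [||a [b' [c abc]]] := @fano_in_large (map f s) _ f0;
  rewrite ?size_map ?map_inj_in_uniq //.
have pre x : x \in fano a b' c -> exists2 v, minvec v & f v = x.
  by move=> /abc/mapP[v vs ->]; exists v => //; apply: ms.
have [u mu fu] := pre a ltac:(by rewrite !inE eqxx ?orbT).
have [v mv fv] := pre b' ltac:(by rewrite !inE eqxx ?orbT).
have [w mw fw] := pre c ltac:(by rewrite !inE eqxx ?orbT).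
have [uv muv fuv] := pre (addc a b') ltac:(by rewrite !inE eqxx ?orbT).
have [uw muw fuw] := pre (addc a c) ltac:(by rewrite !inE eqxx ?orbT).
have [vw mvw fvw] := pre (addc b' c) ltac:(by rewrite !inE eqxx ?orbT).
have [uvw muvw fuvw] := pre (addc (addc a b') c) ltac:(by rewrite !inE eqxx ?orbT).
exfalso; apply: (minvec_no_fano mu mv mw muv muw mvw muvw).
- by apply: ev3; rewrite ?fu ?fv ?fw ?fuv; case: mu mv muv => // ? ? [? ?] [? ?].
- by apply: ev3; rewrite ?fu ?fv ?fw ?fuw; case: mu mw muw => // ? ? [? ?] [? ?].
- by apply: ev3; rewrite ?fu ?fv ?fw ?fvw; case: mv mw mvw => // ? ? [? ?] [? ?].
- by apply: ev3; rewrite ?fuv ?fw ?fuvw; case: muv mw muvw => // ? ? [? ?] [? ?].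
Qed.

End MinimalVectors.

(** * Primitive integer relations between the rows of a rational matrix *)

Lemma primitive_relation (k l : nat) (M : 'M[rat]_(k, l)) : (l < k)%N ->
  exists n : 'I_k -> int, (exists i, ~~ (2 %| n i)%Z) /\
    forall j, \sum_i (n i)%:~R * M i j = 0.
Proof.
move=> ltlk.
have /rowV0Pn[c /sub_kermxP cM c0] : kermx M != 0.
  by rewrite -mxrank_eq0 mxrank_ker subn_eq0 -ltnNge (leq_ltn_trans (rank_leq_col M)).
(* Reading the kernel vector as a polynomial allows clearing denominators and then dividing by the
   content. *)
have [q [a a0 pE]] := rat_poly_scale (rVpoly c).
have q0 : q != 0.
  apply: contraNneq c0 => q0; rewrite -[c]rVpolyK pE q0.
  by rewrite (rmorph0 (map_poly (intr : int -> rat))) scaler0 linear0.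
exists (fun i => (zprimitive q)`_i); split.
  (* Content 1 forces an odd coefficient; its index is below k, since all later coefficients
     vanish. *)
  have : ~~ (2 %| zcontents (zprimitive q))%Z by rewrite zcontents_primitive q0.
  rewrite dvdz_contents => /polyOverP prim.
  apply: contrapT => even_q; apply: prim => i.
  have [ltik|leki] := ltnP i k.
    by apply: contrapT => /negP odd_i; apply: even_q; exists (Ordinal ltik).
  rewrite nth_default ?rpred0 // (leq_trans _ leki) //.
  rewrite size_zprimitive.
  have -> : size q = size (rVpoly c).
    by rewrite pE size_scale ?invr_eq0 ?intr_eq0 // size_map_inj_poly //; apply: intr_inj.
  exact: size_poly.
move=> j; have /matrixP/(_ 0 j) := cM; rewrite !mxE => cMj.
have cE i : c 0 i = a%:~R^-1 * (zcontents q)%:~R * ((zprimitive q)`_i)%:~R.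
  rewrite -coef_rVpoly_ord pE {1}(zpolyEprim q) coefZ coef_map coefZ /= rmorphM /=.
  by rewrite mulrA.
have nz : a%:~R^-1 * (zcontents q)%:~R != 0 :> rat.
  by rewrite mulf_neq0 ?invr_eq0 ?intr_eq0 ?zcontents_eq0.
apply: (mulfI nz); rewrite mulr0 -[RHS]cMj mulr_sumr.
by apply: eq_bigr => i _; rewrite cE mulrA.
Qed.

(** * O_F^2 as a lattice under the real part of the Hermitian form *)

Section HermitianLattice.

Context {R : realType} (d : nat) (A : 'M[R[i]]_2).
Local Open Scope complex_scope.

Definition sesqui (x y : 'cV[R[i]]_2) : R[i] :=
  \sum_(k < 2) \sum_(l < 2) Num.conj (x k ord0) * A k l * y l ord0.

Definition reform (x y : 'cV[R[i]]_2) : R := complex.Re (sesqui x y).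

Definition OF2 (v : 'cV[R[i]]_2) : Prop := forall k, in_OF d (v k ord0).

Lemma reformD x y z : reform (x + y) z = reform x z + reform y z.
Proof.
rewrite /reform; have -> : sesqui (x + y) z = sesqui x z + sesqui y z.
  rewrite /sesqui -big_split; apply: eq_bigr => k _; rewrite -big_split.
  by apply: eq_bigr => l _; rewrite mxE rmorphD !mulrDl.
by case: (sesqui x z) => ? ?; case: (sesqui y z).
Qed.

Lemma reformC x y : Defs.hermitian A -> reform x y = reform y x.
Proof.
move=> hA; rewrite /reform; have -> : sesqui x y = Num.conj (sesqui y x).
  rewrite /sesqui rmorph_sum exchange_big; apply: eq_bigr => l _.
  rewrite rmorph_sum; apply: eq_bigr => k _.
  rewrite !rmorphM /= conjCK -[Num.conj (A l k)]/((A l k)^*) -hA; ring.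
by case: (sesqui y x).
Qed.

Lemma in_OF_sub (z w : R[i]) : in_OF d z -> in_OF d w -> in_OF d (z - w).
Proof.
move=> [[a [b ->]] iz] [[a' [b' ->]] iw]; split.
  by exists (a - a'), (b - b'); rewrite !rmorphB mulrBl addrACA opprD.
case: iz iw => p [p1 pz] [q [q1 qw]].
have [||r r1 rzw] := @integral_sub _ _ (intr : int -> R[i])
  (ratr a + ratr b * ('i * (Num.sqrt (d%:R : R))%:C))
  (ratr a' + ratr b' * ('i * (Num.sqrt (d%:R : R))%:C)).
- by exists p.
- by exists q.
- by exists r.
Qed.

Lemma OF2_sub v w : OF2 v -> OF2 w -> OF2 (v - w).
Proof. by move=> Ov Ow k; rewrite !mxE; apply: in_OF_sub. Qed.

Lemma OF2_0 : OF2 0.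
Proof.
move=> k; rewrite mxE; split; first by exists 0, 0; rewrite !rmorph0 mul0r addr0.
by exists 'X; rewrite monicX map_polyX rootX.
Qed.

(** Writing both entries over 1 and [s] gives each vector four rational coordinates, so five vectors
    are the rows of a 5 by 4 matrix. *)
Lemma OF2_rank4 (e : 'I_5 -> 'cV[R[i]]_2) : (forall i, OF2 (e i)) ->
  exists n : 'I_5 -> int, (exists i, ~~ (2 %| n i)%Z) /\ \sum_i e i *~ n i = 0.
Proof.
move=> Oe.
pose s : R[i] := 'i * (Num.sqrt (d%:R : R))%:C.
have /choice[c cE] : forall ik : 'I_5 * 'I_2, exists ab : rat * rat,
    e ik.1 ik.2 ord0 = ratr ab.1 + ratr ab.2 * s.
  by move=> [i k]; have [[a [b ab]] _] := Oe i k; exists (a, b).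
pose M : 'M[rat]_(5, 2 + 2) :=
  row_mx (\matrix_(i, k) (c (i, k)).1) (\matrix_(i, k) (c (i, k)).2).
have [n [odd_n nM]] := @primitive_relation 5 (2 + 2) M isT.
exists n; split => //; apply/matrixP => k j; rewrite (ord1 j) summxE mxE.
have n1 := nM (lshift 2 k); have n2 := nM (rshift 2 k).
transitivity (ratr (\sum_i (n i)%:~R * (c (i, k)).1) +
  ratr (\sum_i (n i)%:~R * (c (i, k)).2) * s : R[i]).
  rewrite !rmorph_sum mulr_suml -big_split; apply: eq_bigr => i _.
  transitivity ((n i)%:~R * e i k ord0).
    rewrite (ord1 ord0) mulrzl; case: (n i) => p; first exact: mulmxnE.
    by rewrite mxE; congr (- _); exact: mulmxnE.
  by rewrite (cE (i, k)) mulrDr [_ * (_ * s)]mulrA !rmorphM /= !ratr_int.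
have -> : \sum_i (n i)%:~R * (c (i, k)).1 = 0.
  by rewrite -[RHS]n1; apply: eq_bigr => i _; rewrite row_mxEl mxE.
have -> : \sum_i (n i)%:~R * (c (i, k)).2 = 0.
  by rewrite -[RHS]n2; apply: eq_bigr => i _; rewrite row_mxEr mxE.
by rewrite rmorph0 mul0r addr0.
Qed.

Lemma hmin_le v : posdef A -> OF2 v -> v != 0 -> hmin d A <= reform v v.
Proof.
move=> [_ pA] Ov v0; apply: ge_inf; last by exists v.
(* Positivity makes 0 a lower bound, so the infimum is a genuine one. *)
exists 0 => _ [w [_ w0] <-].
by have := pA w w0; rewrite ltcE => /andP[_ /ltW].
Qed.

End HermitianLattice.

Theorem theorem4p1 (R : realType) (d : nat) (A : 'M[R[i]]_2) :
  (0 < d)%N -> posdef A ->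
  forall s : seq 'cV[R[i]]_2, min_reps d A s -> (size s <= 12)%N.
Proof.
move=> _ pA s [min_s rep_s].
have mins v : v \in s -> minvec (reform A) (OF2 d) (hmin d A) v.
  by move=> /min_s[[Ov _] hv]; split=> //; rewrite /reform -[sesqui A v v]/(hform A v) hv.
(* The empty list is trivial; otherwise a member attains the minimum, which is therefore
   positive. *)
have [->//|[v0 v0s v0n]] : s = [::] \/ exists2 v, v \in s & v != 0.
  case: s min_s {rep_s mins} => [|v s] min_s; first by left.
  by right; exists v; rewrite ?mem_head //; case: (min_s v (mem_head _ _)) => [[]].
have m_gt0 : 0 < hmin d A.
  have [_ <-] := mins _ v0s; case: pA => _ /(_ _ v0n).
  by rewrite ltcE => /andP[].
apply: (size_minvecs (fun x y => reformC x y pA.1) (@reformD _ A) (@OF2_0 _ d)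
  (@OF2_sub _ d) m_gt0 _ (@OF2_rank4 _ d) mins).
- by move=> v Ov v_neq0; apply: hmin_le.
- by apply/(uniqP 0) => i j si sj eq_ij; apply: contrapT => /(rep_s i j si sj)[].
- move=> u v us vs uv; have := rep_s (index u s) (index v s).
  rewrite !index_mem !nth_index // => /(_ us vs); case=> //.
  by move=> /(congr1 (nth 0 s)); rewrite !nth_index.
Qed.
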